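(* Let $\mathcal{G}_1$ and $\mathcal{G}_2$ be finite simple graphs of orders $n_1$ and $n_2$, with adjacency eigenvalues $\lambda_{11},\ldots,\lambda_{1n_1}$ of $\mathcal{G}_1$ and $\lambda_{21},\ldots,\lambda_{2n_2}$ of $\mathcal{G}_2$ (listed with multiplicity). Then the characteristic polynomial of the adjacency matrix of the closed neighborhood corona $\mathcal{G}_1\boxtimes\mathcal{G}_2$ is $$f(\mathcal{A}_{\mathcal{G}_1\boxtimes\mathcal{G}_2},x)=\prod_{i=1}^{n_2}(x-\lambda_{2i})^{n_1}\cdot\prod_{i=1}^{n_1}\big[x-\lambda_{1i}-\chi_{\mathcal{A}_{\mathcal{G}_2}}(x)(1+\lambda_{1i})^2\big].$$
   Context: All graphs are finite, simple and undirected. For graphs $\mathcal{G}_1$ (vertices $u_1,\ldots,u_{n_1}$) and $\mathcal{G}_2$ (vertices $v_1,\ldots,v_{n_2}$), the closed neighborhood corona $\mathcal{G}_1\boxtimes\mathcal{G}_2$ is the graph obtained from $\mathcal{G}_1$ and $n_1$ disjoint copies of $\mathcal{G}_2$ (the $i$-th copy having vertices $v^i_1,\ldots,v^i_{n_2}$) by joining every vertex of the $i$-th copy to $u_i$ and to every neighbor of $u_i$ in $\mathcal{G}_1$, for each $i$; its edges are the edges of $\mathcal{G}_1$, the edges of each copy of $\mathcal{G}_2$, and these added edges. For a square matrix $M$ of order $n$, the coronal of $M$ is the rational function $\chi_M(x)=\mathbf{1}_n^T(xI_n-M)^{-1}\mathbf{1}_n$, where $\mathbf{1}_n$ is the all-ones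 column vector; $\mathcal{A}_{\mathcal{G}}$ denotes the adjacency matrix of $\mathcal{G}$ and $f(M,x)=\det(xI-M)$. *)

(* Defs.v *)
From HB Require Import structures.
From mathcomp Require Import all_boot all_order all_algebra.

Set Implicit Arguments.
Unset Strict Implicit.
Unset Printing Implicit Defensive.

Import Order.TTheory GRing.Theory Num.Theory.
Local Open Scope ring_scope.

Record sgraph := SGraph {
  vertex :> finType;
  adj : rel vertex;
  adj_sym : symmetric adj;
  adj_irrefl : irreflexive adj }.

Section ClosedNeighborhoodCorona.
Variables G1 G2 : sgraph.

(* inl u is the vertex u of G1; inr (i, v) is the vertex v of the copy of G2
   attached to the vertex i of G1. *)
Definition cncorona_adj : rel (G1 + G1 * G2)%type := fun x y =>
  match x, y with
  | inl u, inl u' => adj u u'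
  | inl u, inr (i, _) => (u == i) || adj i u
  | inr (i, _), inl u => (u == i) || adj i u
  | inr (i, v), inr (j, w) => (i == j) && adj v w
  end.

Lemma cncorona_adj_sym : symmetric cncorona_adj.
Proof.
move=> [u|[i v]] [u'|[j w]] //=; first exact: adj_sym.
by rewrite eq_sym adj_sym.
Qed.

Lemma cncorona_adj_irrefl : irreflexive cncorona_adj.
Proof. by move=> [u|[i v]] /=; rewrite adj_irrefl ?andbF. Qed.

Definition cncorona : sgraph := SGraph cncorona_adj_sym cncorona_adj_irrefl.

End ClosedNeighborhoodCorona.

(* Rows and columns follow the library enumeration of the vertices. *)
Definition adjmx (R : nzRingType) (G : sgraph) : 'M[R]_#|G| :=
  \matrix_(i, j) (adj (enum_val i) (enum_val j))%:R.

Definition eigenvalues_with_mult (R : fieldType) (n : nat) (M : 'M[R]_n)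
    (l : n.-tuple R) : Prop :=
  forall a : R, count_mem a l = mup a (char_poly M).

Notation "{ 'ratfun' R }" := {fraction {poly R}} : type_scope.

Definition ratfun_of_poly (R : fieldType) (p : {poly R}) : {ratfun R} :=
  FracField.tofrac p.

Definition ratfun_const (R : fieldType) (c : R) : {ratfun R} :=
  ratfun_of_poly c%:P.

Definition ratfun_x (R : fieldType) : {ratfun R} := ratfun_of_poly 'X.

Definition coronal (R : fieldType) (n : nat) (M : 'M[R]_n) : {ratfun R} :=
  let ones : 'cV[{ratfun R}]_n := const_mx 1 in
  (ones^T *m invmx ((ratfun_x R)%:M - map_mx (@ratfun_const R) M) *m ones)
    ord0 ord0.

(* Main.v *)
Require Import Defs.
From HB Require Import structures.
From mathcomp Require Import all_boot all_order all_fingroup all_algebra.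
From mathcomp Require Import mxtens.

Set Implicit Arguments.
Unset Strict Implicit.
Unset Printing Implicit Defensive.

Import Order.TTheory GRing.Theory Num.Theory.
Local Open Scope ring_scope.

(** Indexing the vertices of the corona as V(G1) + V(G1) x V(G2), the matrix
    xI - A is a 2x2 block matrix with blocks xI - A1, - (I + A1) (x) 1^T,
    - (I + A1) (x) 1 and I (x) (xI - A2).  Its lower right block has
    determinant det (xI - A2)^n1, and the corresponding Schur complement is
    xI - A1 - chi (I + A1)^2 with chi the coronal of A2.  Since the
    characteristic polynomial of A1 splits, A1 is similar to a triangular
    matrix, on which the determinant of the Schur complement is read off the
    diagonal. *)

(** * Split characteristic polynomials and triangularization *)

(** Dividing [p] by the factor of the head of [s] lowers one multiplicity and the size by one, so
    induction applies. This turns the eigenvalue hypotheses of the theorem into factorizations of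
    the characteristic polynomials. *)
Lemma monic_prod_XsubC_mup (F : fieldType) (p : {poly F}) (s : seq F) :
  p \is monic -> size p = (size s).+1 ->
  (forall a, count_mem a s = mup a p) -> p = \prod_(a <- s) ('X - a%:P).
Proof.
elim: s p => [|b s IHs] p p_mon sz_p mup_p.
  by rewrite big_nil; apply/eqP; rewrite -eqp_monic ?monic1 // -size_poly_eq1 sz_p.
have p0 : p != 0 by rewrite monic_neq0.
have : ('X - b%:P) %| p by rewrite XsubC_dvd // -mup_p /= eqxx.
rewrite dvdp_XsubCl => /factor_theorem[q Dp].
have q_mon : q \is monic by rewrite -(monicMr _ (monicXsubC b)) -Dp.
rewrite big_cons mulrC {1}Dp; congr (_ * _); apply: IHs => // [|a].
  move: sz_p; rewrite Dp size_Mmonic ?monicXsubC ?monic_neq0 // size_XsubC.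
  by rewrite addn2 => -[].
have := mup_p a; rewrite Dp mupM ?monic_neq0 ?monicXsubC //.
rewrite -['X - b%:P]expr1 mup_XsubCX addnC /=.
by case: (b == a) => /addnI.
Qed.

Lemma is_trig_mxM (R : pzRingType) n (A B : 'M[R]_n) :
  is_trig_mx A -> is_trig_mx B ->
  is_trig_mx (A *m B) /\ forall i, (A *m B) i i = A i i * B i i.
Proof.
move=> /is_trig_mxP tA /is_trig_mxP tB; split=> [|i].
  apply/is_trig_mxP=> i j ij; rewrite mxE big1 // => k _.
  have [ik|ki] := ltnP i k; first by rewrite tA ?mul0r.
  by rewrite [B _ _]tB ?mulr0 // (leq_ltn_trans ki).
rewrite mxE (bigD1 i) //= big1 ?addr0 // => k; rewrite neq_ltn => /orP[ki|ik].
  by rewrite [B _ _]tB ?mulr0.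
by rewrite tA ?mul0r.
Qed.

Lemma char_poly_similar (F : fieldType) n (P A B : 'M[F]_n) :
  P \in unitmx -> P *m A = B *m P -> char_poly A = char_poly B.
Proof.
move=> uP PA.
have eqPA : map_mx polyC P *m char_poly_mx A = char_poly_mx B *m map_mx polyC P.
  by rewrite mulmxBr mulmxBl -!map_mxM PA scalar_mxC.
have := congr1 determinant eqPA; rewrite !det_mulmx mulrC => /mulIf; apply.
by rewrite det_map_mx polyC_eq0 -unitfE.
Qed.

Lemma char_poly_lblock (R : comNzRingType) m n (A : 'M[R]_m) (C : 'M[R]_(n, m))
    (D : 'M[R]_n) :
  char_poly (block_mx A 0 C D) = char_poly A * char_poly D.
Proof.
rewrite /char_poly /char_poly_mx map_block_mx scalar_mx_block opp_block_mx.
by rewrite add_block_mx map_mx0 oppr0 addr0 det_lblock.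
Qed.

(** Completing an eigenvector for the first root to a basis splits off a block of order 1.
    Cancelling its factor leaves the lower right block with the remaining roots, and induction
    applies to it. *)
Lemma split_char_poly_trig (F : fieldType) n (A : 'M[F]_n) (s : seq F) :
  char_poly A = \prod_(a <- s) ('X - a%:P) ->
  exists P T : 'M[F]_n, [/\ P \in unitmx, is_trig_mx T & P *m A = T *m P].
Proof.
elim: n A s => [|n IHn] A s DA.
  exists 1%:M, A; split; rewrite ?unitmx1 ?mul1mx ?mulmx1 //.
  by apply/is_trig_mxP=> -[].
case: s DA => [|a s] DA.
  by have := size_char_poly A; rewrite DA big_nil size_poly1.
have : eigenvalue A a.
  by rewrite eigenvalue_root_char DA big_cons rootM root_XsubC eqxx.
case/eigenvalueP=> v vA v0.
(* The first row of [row_ebase v] is a multiple of the eigenvector [v]. *)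
pose Q : 'M_(1 + n) := row_ebase v; pose B : 'M_(1 + n) := Q *m A *m invmx Q.
have uQ : Q \in unitmx by exact: row_ebase_unit.
have QA : Q *m A = B *m Q by rewrite mulmxKV.
have DB : B = block_mx a%:M 0 (dlsubmx B) (drsubmx B).
  suff: usubmx B = row_mx a%:M 0.
    by move=> uB; rewrite -[LHS]vsubmxK uB -[dsubmx B]hsubmxK block_mxEv.
  have Dv : v = col_ebase v *m (row_mx 1%:M 0 : 'M_(1, 1 + n)) *m Q.
    by rewrite -pid_mx_row -{1}[v]mulmx_ebase rank_rV v0.
  have uc := col_ebase_unit v.
  have -> : usubmx B = (row_mx 1%:M 0 : 'M_(1, 1 + n)) *m B.
    by rewrite -{2}[B]vsubmxK mul_row_col mul1mx mul0mx addr0.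
  (* Multiplying by the invertible matrix [col_ebase v] of order 1 turns the first row of [Q] into
     [v] itself, so that [vA] can be used. *)
  apply: (can_inj (mulKmx uc)).
  rewrite /B !mulmxA -Dv vA {1}Dv -scalemxAl mulmxK //.
  by rewrite scalemxAr scale_row_mx scaler0 scalemx1.
have := char_poly_similar uQ QA.
rewrite {1}DB char_poly_lblock DA big_cons.
rewrite [char_poly a%:M]/char_poly det_mx11 !mxE eqxx !mulr1n.
move/mulfI; rewrite polyXsubC_eq0 => /(_ isT)/esym/IHn[P [T [uP tT PD]]].
(* The inductive [P] acts on the last [n] coordinates only; conjugating [B] this way multiplies its
   lower left block by [P]. *)
exists (block_mx 1%:M 0 0 P *m Q), (block_mx a%:M 0 (P *m dlsubmx B) T); split.
- by rewrite unitmx_mul uQ andbT unitmxE (@det_lblock _ 1 n) det1 mul1r.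
- by rewrite (@is_trig_block_mx _ 1 n 1 n) // eqxx tT scalar_mx_is_trig.
rewrite -mulmxA QA [LHS]mulmxA [RHS]mulmxA; congr (_ *m _).
rewrite [in LHS]DB !(@mulmx_block _ 1 n 1 n 1 n) PD.
by rewrite !(mul0mx, mulmx0, mul1mx, mulmx1, add0r, addr0).
Qed.

(** Conjugation commutes with polynomial expressions in the matrix, so a triangular form found over
    [F] can be carried to [K] by [f]. The scalars [x] and [c] need not come from [F]: they will be
    the indeterminate and the coronal. *)
Lemma det_quadratic_mx (F K : fieldType) (f : {rmorphism F -> K}) n
    (A : 'M[F]_n) (s : seq F) (x c : K) :
  char_poly A = \prod_(a <- s) ('X - a%:P) ->
  \det (x%:M - map_mx f A - c *: ((1%:M + map_mx f A) *m (1%:M + map_mx f A))) =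
    \prod_(a <- s) (x - f a - c * (1 + f a) ^+ 2).
Proof.
move=> DA; have [P [T [uP tT PA]]] := split_char_poly_trig DA.
pose g (M : 'M[K]_n) := x%:M - M - c *: ((1%:M + M) *m (1%:M + M)).
have PAf : map_mx f P *m map_mx f A = map_mx f T *m map_mx f P.
  by rewrite -!map_mxM PA.
have Pg : map_mx f P *m g (map_mx f A) = g (map_mx f T) *m map_mx f P.
  have P1 : map_mx f P *m (1%:M + map_mx f A) =
      (1%:M + map_mx f T) *m map_mx f P.
    by rewrite mulmxDr mulmxDl PAf mul1mx mulmx1.
  rewrite /g !mulmxBr !mulmxBl PAf scalar_mxC -scalemxAr -scalemxAl.
  by rewrite mulmxA P1 -!mulmxA P1.
have tTf : is_trig_mx (map_mx f T).
  by apply/is_trig_mxP=> i j ij; rewrite mxE (is_trig_mxP tT) ?rmorph0.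
have tT1 : is_trig_mx (1%:M + map_mx f T).
  apply/is_trig_mxP=> i j ij; rewrite mxE (is_trig_mxP tTf) // addr0.
  by rewrite (is_trig_mxP (scalar_mx_is_trig _ _)).
have [tTT dTT] := is_trig_mxM tT1 tT1.
have -> : \det (g (map_mx f A)) = \det (g (map_mx f T)).
  have := congr1 determinant Pg; rewrite !det_mulmx mulrC => /mulIf; apply.
  by rewrite det_map_mx fmorph_eq0 -unitfE.
have gE M i j : g M i j =
    x%:M i j - M i j - c * ((1%:M + M) *m (1%:M + M)) i j by rewrite !mxE.
rewrite det_trig; last first.
  apply/is_trig_mxP=> i j ij; rewrite gE.
  rewrite (is_trig_mxP tTf) // (is_trig_mxP tTT) //.
  by rewrite (is_trig_mxP (scalar_mx_is_trig _ _)) // mulr0 !subr0.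
(* Both lists give a factorization of the same characteristic polynomial into linear factors. *)
have : perm_eq s [seq T i i | i : 'I_n].
  apply: prod_XsubC_eq; rewrite -DA (char_poly_similar uP PA) char_poly_trig //.
  by rewrite big_image.
move/(perm_big _)=> ->; rewrite big_image; apply: eq_bigr => i _ /=.
by rewrite gE dTT !mxE eqxx !mulr1n expr2.
Qed.

(** * Determinants of block, reindexed and Kronecker matrices *)

Lemma det_schur (R : comUnitRingType) m n (A : 'M[R]_m) (B : 'M[R]_(m, n))
    (C : 'M[R]_(n, m)) (D : 'M[R]_n) : D \in unitmx ->
  \det (block_mx A B C D) = \det (A - B *m invmx D *m C) * \det D.
Proof.
move=> uD.
have -> : block_mx A B C D =
    block_mx (A - B *m invmx D *m C) (B *m invmx D) 0 1%:M *m block_mx 1%:M 0 C D.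
  by rewrite mulmx_block !mulmx1 !mul1mx !mul0mx !mulmx0 mulmxKV // subrK !add0r.
by rewrite det_mulmx det_ublock det_lblock !det1 mulr1 mul1r.
Qed.

(** Two enumerations of [T] differ by a permutation applied to both rows and columns, whose sign
    occurs twice and cancels. *)
Lemma det_reindex (R : comNzRingType) (T : finType) (M : T -> T -> R) m n
    (g : 'I_m -> T) (h : 'I_n -> T) : bijective g -> bijective h ->
  \det (\matrix_(i, j) M (g i) (g j)) = \det (\matrix_(i, j) M (h i) (h j)).
Proof.
move=> bg bh; have eq_mn : m = n.
  by rewrite -(card_ord m) -(card_ord n) (bij_eq_card bg) (bij_eq_card bh).
case: n / eq_mn in h bh *; case: bh => h' h'K hK.
have inj_s : injective (h' \o g).
  by apply: inj_comp; [exact: can_inj hK | exact: bij_inj].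
have -> : \matrix_(i, j) M (g i) (g j) =
    row_perm (perm inj_s) (col_perm (perm inj_s) (\matrix_(i, j) M (h i) (h j))).
  by apply/matrixP=> i j; rewrite !mxE !permE /= !hK.
rewrite row_permE col_permE !det_mulmx !det_perm odd_permV mulrCA.
by rewrite -signr_addb addbb mulr1.
Qed.

Lemma det_castmx (R : comNzRingType) m n (eq_mn : m = n) (A : 'M[R]_m) :
  \det (castmx (eq_mn, eq_mn) A) = \det A.
Proof. by case: n / eq_mn. Qed.

Lemma det_tens1mx (R : comNzRingType) m n (N : 'M[R]_n) :
  \det ((1%:M : 'M_m) *t N) = \det N ^+ m.
Proof.
elim: m => [|m IHm]; first by rewrite det_mx00.
rewrite [1%:M](@scalar_mx_block _ 1 m) tens_block_mx tens0mx.
by rewrite det_castmx det_lblock IHm tens_scalar1mx det_castmx exprS.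
Qed.

Lemma tens1mx1 (R : pzRingType) m n :
  (1%:M : 'M[R]_m) *t (1%:M : 'M_n) = 1%:M.
Proof.
apply/matrixP=> i j; case: (mxtens_indexP i) => i0 i1.
case: (mxtens_indexP j) => j0 j1; rewrite tensmxE !mxE -natrM mulnb.
by rewrite (can_eq (@mxtens_indexK _ _)) xpair_eqE.
Qed.

Lemma invmx_tens1mx (R : comUnitRingType) m n (N : 'M[R]_n) : N \in unitmx ->
  ((1%:M : 'M_m) *t N \in unitmx) *
  (invmx ((1%:M : 'M_m) *t N) = 1%:M *t invmx N).
Proof.
move=> uN; have N1 : (1%:M : 'M_m) *t N *m (1%:M *t invmx N) = 1%:M.
  by rewrite tensmx_mul mul1mx mulmxV // tens1mx1.
have [u _] := mulmx1_unit N1; split=> //.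
by rewrite -[RHS](mulKmx u) N1 mulmx1.
Qed.

Lemma tofrac_char_poly (F : fieldType) n (M : 'M[F]_n) :
  ratfun_of_poly (char_poly M) =
  \det ((ratfun_x F)%:M - map_mx (@ratfun_const F) M).
Proof.
by rewrite /ratfun_of_poly -det_map_mx map_mxB map_scalar_mx -map_mx_comp //.
Qed.

(** * The determinant of the corona *)

Section CoronaDeterminant.

Variables (G1 G2 : sgraph).
Let n1 := #|G1|.
Let n2 := #|G2|.

(* The vertices of G1 are indexed by 'I_(n1 * 1) so that all four blocks of
   the adjacency matrix of the corona are Kronecker products. *)
Definition corona_vertex (k : 'I_(n1 * 1 + n1 * n2)) : cncorona G1 G2 :=
  match split k with
  | inl i => inl (enum_val (mxtens_unindex i).1)
  | inr j => inr (enum_val (mxtens_unindex j).1, enum_val (mxtens_unindex j).2)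
  end.

Definition corona_index (v : cncorona G1 G2) : 'I_(n1 * 1 + n1 * n2) :=
  match v with
  | inl u => lshift _ (mxtens_index (enum_rank u, ord0))
  | inr (u, w) => rshift _ (mxtens_index (enum_rank u, enum_rank w))
  end.

Lemma corona_vertex_bij : bijective corona_vertex.
Proof.
exists corona_index => [k|[u|[u w]]].
- rewrite -[k]splitK /corona_vertex unsplitK; case: (split k) => i.
    case: (mxtens_indexP i) => a b.
    by rewrite mxtens_indexK /= enum_valK [b]ord1.
  case: (mxtens_indexP i) => a b.
  by rewrite mxtens_indexK /= !enum_valK.
- rewrite /corona_vertex /corona_index.
  by rewrite (unsplitK (inl _)) mxtens_indexK /= enum_rankK.
rewrite /corona_vertex /corona_index.
by rewrite (unsplitK (inr _)) mxtens_indexK /= !enum_rankK.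
Qed.

Variable K : fieldType.
Variable x : K.
Let A1 := adjmx K G1.
Let A2 := adjmx K G2.
Let J : 'cV[K]_n2 := const_mx 1.

Lemma det_cncorona : x%:M - A2 \in unitmx ->
  \det (x%:M - adjmx K (cncorona G1 G2)) =
  \det (x%:M - A2) ^+ n1 *
  \det (x%:M - A1 -
    (J^T *m invmx (x%:M - A2) *m J) ord0 ord0 *: ((1%:M + A1) *m (1%:M + A1))).
Proof.
move=> uA2; pose M (u v : cncorona G1 G2) : K := x *+ (u == v) - (adj u v)%:R.
have -> : x%:M - adjmx K (cncorona G1 G2) =
    \matrix_(i, j) M (enum_val i) (enum_val j).
  by apply/matrixP=> i j; rewrite !mxE /M (inj_eq enum_val_inj).
rewrite (det_reindex M (enum_val_bij _) corona_vertex_bij).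
(* Equality and adjacency exclude each other, so their disjunction is a sum: an entry of
   [1%:M + A1]. *)
have adj1 (a c : 'I_n1) :
    ((enum_val a == enum_val c) || adj (enum_val a) (enum_val c))%:R =
    (a == c)%:R + (adj (enum_val a) (enum_val c))%:R :> K.
  rewrite (inj_eq enum_val_inj); case: eqP => [->|_]; last by rewrite add0r.
  by rewrite adj_irrefl addr0.
have -> : \matrix_(i, j) M (corona_vertex i) (corona_vertex j) =
    block_mx ((x%:M - A1) *t (1%:M : 'M_1)) (- ((1%:M + A1) *t J^T))
             (- ((1%:M + A1) *t J)) ((1%:M : 'M_n1) *t (x%:M - A2)).
  apply/matrixP=> i j; rewrite mxE /corona_vertex.
  rewrite -[i]splitK -[j]splitK.
  case: (split i) => {}i; case: (split j) => {}j; rewrite !unsplitK;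
  rewrite ?(block_mxEul, block_mxEur, block_mxEdl, block_mxEdr);
  case: (mxtens_indexP i) => a b; case: (mxtens_indexP j) => c d;
  rewrite !mxE !mxtens_indexK /M /=.
  - rewrite [b]ord1 [d]ord1 eqxx mulr1 (inj_eq (@inl_inj _ _)).
    by rewrite (inj_eq enum_val_inj).
  - by rewrite mulr0n sub0r mulr1 -adj1 [in RHS]adj_sym.
  - by rewrite mulr0n sub0r mulr1 -adj1 [in RHS]eq_sym.
  - rewrite (inj_eq (@inr_inj _ _)) xpair_eqE !(inj_eq enum_val_inj).
    by case: (a == c); rewrite /= ?mul1r // subr0 mul0r.
have [u iu] := invmx_tens1mx n1 uA2.
rewrite det_schur // mulrC det_tens1mx iu; congr (_ * _).
(* The two signs cancel, and the mixed product rule gathers the all-ones vectors around the inverse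
   in a right factor of order 1, hence a scalar. *)
rewrite !mulNmx mulmxN opprK !tensmx_mul mulmx1.
set c := (J^T *m _ *m J) ord0 ord0; rewrite [J^T *m _ *m J]mx11_scalar -/c.
have -> : (x%:M - A1) *t 1%:M - (1%:M + A1) *m (1%:M + A1) *t c%:M =
    (x%:M - A1 - c *: ((1%:M + A1) *m (1%:M + A1))) *t (1%:M : 'M_1).
  apply/matrixP=> i j; case: (mxtens_indexP i) => a b.
  case: (mxtens_indexP j) => d e; rewrite [LHS]mxE [X in _ + X]mxE !tensmxE.
  rewrite [b]ord1 [e]ord1 ![_%:M ord0 ord0]mxE !mulr1n !mulr1.
  by rewrite [RHS]mxE [X in _ = _ + X]mxE [X in _ = _ - X]mxE [c * _]mulrC.
by rewrite tens_mx_scalar det_castmx scale1r.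
Qed.

End CoronaDeterminant.

(** * The identity over the field of rational functions *)

Theorem theorem1 (R : rcfType) (G1 G2 : sgraph)
    (lambda1 : #|G1|.-tuple R) (lambda2 : #|G2|.-tuple R)
    (h1 : eigenvalues_with_mult (adjmx R G1) lambda1)
    (h2 : eigenvalues_with_mult (adjmx R G2) lambda2) :
  ratfun_of_poly (char_poly (adjmx R (cncorona G1 G2))) =
    (\prod_(i < #|G2|)
       (ratfun_x R - ratfun_const (tnth lambda2 i)) ^+ #|G1|) *
    (\prod_(i < #|G1|)
       (ratfun_x R - ratfun_const (tnth lambda1 i)
        - coronal (adjmx R G2) * (1 + ratfun_const (tnth lambda1 i)) ^+ 2)).
Proof.
have adjmxE G : map_mx (@ratfun_const R) (adjmx R G) = adjmx {ratfun R} G.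
  apply/matrixP=> i j; rewrite !mxE /ratfun_const polyC_natr.
  by rewrite /ratfun_of_poly rmorph_nat.
have D1 := monic_prod_XsubC_mup (char_poly_monic _)
  (etrans (size_char_poly _) (congr1 S (esym (size_tuple _)))) h1.
have D2 := monic_prod_XsubC_mup (char_poly_monic _)
  (etrans (size_char_poly _) (congr1 S (esym (size_tuple _)))) h2.
have det2 : \det ((ratfun_x R)%:M - adjmx {ratfun R} G2) =
    ratfun_of_poly (char_poly (adjmx R G2)).
  by rewrite tofrac_char_poly adjmxE.
(* At the indeterminate, the matrix for [G2] is invertible because its determinant is the image of a
   monic, hence nonzero, polynomial. *)
rewrite tofrac_char_poly adjmxE det_cncorona; last first.
  by rewrite unitmxE unitfE det2 tofrac_eq0 monic_neq0 ?char_poly_monic.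
pose ones : 'cV[{ratfun R}]_#|G2| := const_mx 1.
have coronalE : coronal (adjmx R G2) = (ones^T *m
    invmx ((ratfun_x R)%:M - adjmx {ratfun R} G2) *m ones) ord0 ord0.
  by rewrite /coronal adjmxE.
rewrite det2 -coronalE -(adjmxE G1).
(* [ratfun_const] is convertible to this composite, which carries the ring morphism structure that
   [det_quadratic_mx] requires. *)
pose cst : {rmorphism R -> {ratfun R}} := @FracField.tofrac {poly R} \o polyC.
have -> : @ratfun_const R = cst by [].
rewrite (det_quadratic_mx cst _ _ D1) D2 !big_tuple; congr (_ * _).
rewrite prodrXl /ratfun_of_poly rmorph_prod; congr (_ ^+ _).
by apply: eq_bigr => i _; rewrite rmorphB.
Qed.
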